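(* Let $E,F$ be Banach spaces and suppose that for $i=1,2$ the operator $\mathcal{A}_i$ generates on $\mathcal{E}=E\times F$ the strongly continuous semigroup $(\mathcal{T}_i(t))_{t\ge0}$ of upper triangular form $$\mathcal{T}_i(t)=\begin{pmatrix}T_i(t)&R_i(t)\\0&S_i(t)\end{pmatrix}.$$ If there exist $M'\ge1$, $K>0$ and $\omega'\in\mathbb{R}$ such that for all $i=1,2$, $t\ge0$ and $n\in\mathbb{N}$ (i) $\|(T_2(\frac tn)T_1(\frac tn))^n\|\le M'\mathrm{e}^{\omega't}$ and $\|(S_2(\frac tn)S_1(\frac tn))^n\|\le M'\mathrm{e}^{\omega't}$, (ii) $\|R_i(t)\|\le Kt\cdot\mathrm{e}^{\omega't}$, then there are $M\ge1$ and $\omega\in\mathbb{R}$ such that $$\bigl\|\bigl(\mathcal{T}_2(\tfrac tn)\mathcal{T}_1(\tfrac tn)\bigr)^n\bigr\|\le M\mathrm{e}^{\omega t}\quad\text{for all }t\ge0\text{ and }n\in\mathbb{N}.$$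
   Context: Operators on $E\times F$ are written as $2\times2$ matrices acting on columns; here $T_i(t)\in\mathcal{L}(E)$, $R_i(t)\in\mathcal{L}(F,E)$, $S_i(t)\in\mathcal{L}(F)$. $\mathbb{N}=\{1,2,\dots\}$. The norm on $\mathcal{E}$ is any of the usual (equivalent) product norms. *)

(* Defs.v *)
From Stdlib Require Import Reals.
From Coquelicot Require Import Coquelicot.
Set Implicit Arguments.
Unset Strict Implicit.
Open Scope R_scope.

(* "Banach space" means real or complex Banach space. *)
Inductive scalar_field : Set := RealScalars | ComplexScalars.

Definition scalars (k : scalar_field) : AbsRing :=
  match k with
  | RealScalars => R_AbsRing
  | ComplexScalars => C_AbsRing
  end.

Definition of_R (k : scalar_field) : R -> scalars k :=
  match k with
  | RealScalars => fun r => r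
  | ComplexScalars => RtoC
  end.

(* Extended-real valued: the value is p_infty when [A] is unbounded, so
   [Rbar_le (op_norm A) c] with [c : R] never holds by a default value. *)
Definition op_norm (k : scalar_field) (X Y : NormedModule (scalars k))
    (A : X -> Y) : Rbar :=
  Lub_Rbar (fun r => exists x : X, norm x <= 1 /\ r = norm (A x)).

(* A family indexed by all of [R]; only its values at t >= 0 matter. The
   predicate [is_linear] includes boundedness. *)
Record C0_semigroup (k : scalar_field) (X : NormedModule (scalars k))
    (T : R -> X -> X) : Prop := {
  C0_bounded_linear : forall t, 0 <= t -> is_linear (T t);
  C0_zero : forall x, T 0 x = x;
  C0_add : forall s t x, 0 <= s -> 0 <= t -> T (s + t) x = T s (T t x);
  C0_continuous : forall x t, 0 <= t ->
    filterlim (fun s => T s x) (within (fun s => 0 <= s) (locally t))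
      (locally (T t x))
}.

(* A possibly unbounded operator; [op_fun] is only meaningful on [op_dom]. *)
Record operator (X : Type) := Operator {
  op_dom : X -> Prop;
  op_fun : X -> X
}.

Definition orbit_right_derivative (k : scalar_field)
    (X : NormedModule (scalars k)) (T : R -> X -> X) (x y : X) : Prop :=
  filterlim (fun h => scal (of_R k (/ h)) (minus (T h x) x))
    (at_right 0) (locally y).

Definition generates (k : scalar_field) (X : NormedModule (scalars k))
    (A : operator X) (T : R -> X -> X) : Prop :=
  C0_semigroup T /\
  (forall x, op_dom A x <-> exists y, orbit_right_derivative T x y) /\
  (forall x, op_dom A x -> orbit_right_derivative T x (op_fun A x)).

(* The norm of [prod_NormedModule] is sqrt (|x|^2 + |y|^2). *)
Definition upper_triangular (k : scalar_field)
    (E F : NormedModule (scalars k))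
    (T : E -> E) (U : F -> E) (S : F -> F)
    (z : prod_NormedModule (scalars k) E F) :
    prod_NormedModule (scalars k) E F :=
  (plus (T (fst z)) (U (snd z)), S (snd z)).

Definition trotter_product (X : Type) (T1 T2 : R -> X -> X) (t : R) (n : nat) :
    X -> X :=
  Nat.iter n (fun x => T2 (t / INR n) (T1 (t / INR n) x)).

(* Main.v *)
Require Import Defs.
From Stdlib Require Import Reals Lra Lia Classical IndefiniteDescription.
From Coquelicot Require Import Coquelicot.
Set Implicit Arguments.
Unset Strict Implicit.
Open Scope R_scope.

(** Fix a step s and write the product of the two triangular operators at s as
    one triangular operator with diagonal entries P = T2(s) T1(s) and
    V = S2(s) S1(s) and corner Q = T2(s) R1(s) + R2(s) S1(s).  Its n-th power
    has diagonal entries P^n and V^n, which the stability hypothesis on the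
    products of the Ti and of the Si controls, and corner the sum over j < n of
    P^(n-1-j) Q V^j.

    The stability hypothesis, read at time m s with m factors, says that
    |P^m| and |V^m| are at most M' r^m with r = exp(w' s).  This form is
    multiplicative in m, so if |Q| <= q r, every summand of the corner is at
    most M'^2 q r^n, whatever j is, and the corner is at most n M'^2 q r^n
    ([fst_iter_upper_triangular_le]).  When s = t/n the factor r^n is exp(w' t).
    What remains is that the n summands must not accumulate, that is, q must be
    of order s: the hypothesis on the Ri gives each Ri(s) a factor s, and the
    other factors of Q, namely T2(s) and S1(s), must be bounded by C exp(w s).

    The stability hypothesis bounds products only and never T2(s) or S1(s)
    alone.  Their bounds come from the semigroup property
    ([C0_semigroup_exponential_bound]): a diagonal corner of a strongly
    continuous triangular semigroup is itself a strongly continuous semigroup,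
    its orbits are bounded near time zero, and the uniform boundedness principle
    makes this uniform over the unit ball.  The principle is proved here by a
    gliding hump ([condensation_of_singularities]). *)

(** * Operator norms over real or complex scalars *)

Lemma scal_of_R_assoc (k : scalar_field) (X : NormedModule (scalars k))
    (a b : R) (x : X) :
  scal (of_R k a) (scal (of_R k b) x) = scal (of_R k (a * b)) x.
Proof.
  rewrite scal_assoc. f_equal. destruct k; [reflexivity|].
  symmetry; apply RtoC_mult.
Qed.

Lemma scal_of_R_one (k : scalar_field) (X : NormedModule (scalars k)) (x : X) :
  scal (of_R k 1) x = x.
Proof. destruct k; exact (scal_one x). Qed.

Lemma norm_scal_of_R_le (k : scalar_field) (X : NormedModule (scalars k))
    (a : R) (x : X) :
  0 <= a -> norm (scal (of_R k a) x) <= a * norm x.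
Proof.
  intros Ha. rewrite <- (Rabs_pos_eq a Ha) at 2.
  replace (Rabs a) with (abs (of_R k a)); [apply norm_scal|].
  destruct k; [reflexivity|]. exact (Cmod_R a).
Qed.

Lemma bounded_by_unit_ball (k : scalar_field) (X Y : NormedModule (scalars k))
    (A : X -> Y) (c : R) :
  is_linear A -> (forall x, norm x <= 1 -> norm (A x) <= c) ->
  forall x, norm (A x) <= c * norm x.
Proof.
  intros HA Hc x.
  destruct (Req_dec (norm x) 0) as [H0 | H0].
  - rewrite (norm_eq_zero x H0), (linear_zero A HA), !norm_zero. lra.
  - assert (Hx : 0 < norm x) by (pose proof (norm_ge_0 x); lra).
    set (u := scal (of_R k (/ norm x)) x).
    assert (Hu : norm u <= 1).
    { unfold u. replace 1 with (/ norm x * norm x) by (field; lra).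
      apply norm_scal_of_R_le, Rlt_le, Rinv_0_lt_compat, Hx. }
    assert (Hxu : x = scal (of_R k (norm x)) u).
    { unfold u. rewrite scal_of_R_assoc, Rinv_r, scal_of_R_one by lra.
      reflexivity. }
    rewrite Hxu at 1. rewrite (linear_scal A HA).
    eapply Rle_trans; [apply norm_scal_of_R_le; lra|].
    rewrite (Rmult_comm c). apply Rmult_le_compat_l; [lra|]. now apply Hc.
Qed.

Lemma op_norm_le (k : scalar_field) (X Y : NormedModule (scalars k))
    (A : X -> Y) (c : R) :
  Rbar_le (op_norm A) c <-> (forall x, norm x <= 1 -> norm (A x) <= c).
Proof.
  unfold op_norm.
  destruct (Lub_Rbar_correct
    (fun r => exists x : X, norm x <= 1 /\ r = norm (A x))) as [Hub Hleast].
  split.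
  - intros Hc x Hx.
    exact (Rbar_le_trans (norm (A x)) _ c
             (Hub (norm (A x)) (ex_intro _ x (conj Hx eq_refl))) Hc).
  - intros Hc. apply Hleast. intros r [x [Hx ->]]. exact (Hc x Hx).
Qed.

Lemma op_norm_le_linear (k : scalar_field) (X Y : NormedModule (scalars k))
    (A : X -> Y) (c : R) :
  is_linear A -> Rbar_le (op_norm A) c ->
  forall x, norm (A x) <= c * norm x.
Proof.
  intros HA Hc. apply (bounded_by_unit_ball HA). now apply op_norm_le.
Qed.

(** The first step of a gliding hump: [c] is the norm of [A], and [v] is a vector
    of length at most [r] that almost attains it.  The norm enters only through
    the two inequalities that the hump construction uses. *)
Lemma near_norming_vector (k : scalar_field) (X Y : NormedModule (scalars k))
    (A : X -> Y) (a r : R) :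
  is_linear A -> 0 < a -> 0 < r -> ~ (forall x, norm (A x) <= a * norm x) ->
  exists (c : R) (v : X), a <= c /\ (forall x, norm (A x) <= c * norm x) /\
    norm v <= r /\ 2 / 3 * c * r <= norm (A v).
Proof.
  intros HA Ha Hr Hbig.
  destruct (linear_norm A HA) as [B [HB HAB]].
  assert (HB' : Rbar_le (op_norm A) B).
  { apply op_norm_le. intros x Hx. eapply Rle_trans; [apply HAB|]. nra. }
  assert (Hna : ~ Rbar_le (op_norm A) a).
  { intros H. apply Hbig, op_norm_le_linear; assumption. }
  destruct (op_norm A) as [c | | ] eqn:Hc; [| easy | now elim Hna].
  simpl in Hna.
  assert (Hv : exists u, norm u <= 1 /\ 2 / 3 * c < norm (A u)).
  { apply NNPP. intros Hno.
    assert (Hle : Rbar_le (op_norm A) (2 / 3 * c)).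
    { apply op_norm_le. intros x Hx. apply Rnot_lt_le. intros H.
      apply Hno. now exists x. }
    rewrite Hc in Hle. simpl in Hle. lra. }
  destruct Hv as [u [Hu1 Hu2]].
  set (v := scal (of_R k r) u).
  exists c, v. repeat split.
  - lra.
  - apply op_norm_le_linear; [assumption|]. rewrite Hc. apply Rle_refl.
  - eapply Rle_trans; [apply norm_scal_of_R_le; lra|]. nra.
  - assert (Huv : u = scal (of_R k (/ r)) v).
    { unfold v. rewrite scal_of_R_assoc, Rinv_l, scal_of_R_one by lra.
      reflexivity. }
    assert (Hir : 0 < / r) by (apply Rinv_0_lt_compat, Hr).
    pose proof (norm_scal_of_R_le (A v) (Rlt_le _ _ Hir)) as H.
    rewrite <- (linear_scal A HA), <- Huv in H.
    apply (Rmult_le_compat_l r) in H; [|lra].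
    rewrite <- Rmult_assoc, Rinv_r, Rmult_1_l in H by lra. nra.
Qed.

(** * The uniform boundedness principle *)

Lemma norm_minus_diag (K : AbsRing) (X : NormedModule K) (x : X) :
  norm (minus x x) = 0.
Proof. rewrite minus_eq_zero. exact norm_zero. Qed.

Lemma norm_minus_trans (K : AbsRing) (X : NormedModule K) (y x z : X) :
  norm (minus x z) <= norm (minus x y) + norm (minus y z).
Proof. rewrite (minus_trans y x z). exact (norm_triangle _ _). Qed.

Lemma norm_minus_sym (K : AbsRing) (X : NormedModule K) (x y : X) :
  norm (minus x y) = norm (minus y x).
Proof. rewrite <- opp_minus. exact (norm_opp _). Qed.

Lemma geometric_steps_limit (K : AbsRing) (X : CompleteNormedModule K)
    (x : nat -> (X : NormedModule K)) :
  (forall n, norm (minus (x (S n)) (x n)) <= (1 / 3) ^ n) ->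
  exists l : (X : NormedModule K),
    forall n, norm (minus l (x n)) <= 3 / 2 * (1 / 3) ^ n.
Proof.
  intros Hstep.
  (* The constant is the sum of the geometric series of ratio 1/3. *)
  assert (Hfar : forall n j,
            norm (minus (x (n + j)%nat) (x n)) <= 3 / 2 * (1 / 3) ^ n).
  { assert (H : forall n j, norm (minus (x (n + j)%nat) (x n))
                  <= 3 / 2 * ((1 / 3) ^ n - (1 / 3) ^ (n + j))).
    { intros n j. induction j as [|j IH].
      - rewrite Nat.add_0_r. rewrite norm_minus_diag. lra.
      - rewrite Nat.add_succ_r, (minus_trans (x (n + j)%nat)).
        eapply Rle_trans; [apply norm_triangle|].
        specialize (Hstep (n + j)%nat). simpl pow. lra. }
    intros n j. specialize (H n j).
    assert (0 < (1 / 3) ^ (n + j)) by (apply pow_lt; lra). lra. }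
  destruct (proj1 (filterlim_locally_cauchy (U := X) (F := eventually) x)) as [l Hl].
  { intros eps.
    destruct (pow_lt_1_zero (1 / 3)) with (y := eps / 3) as [N HN].
    { rewrite Rabs_pos_eq; lra. }
    { destruct eps; simpl; lra. }
    exists (fun n => (N <= n)%nat). split; [now exists N|].
    intros u v Hu Hv. apply (norm_compat1 (V := X)).
    specialize (HN N (Nat.le_refl N)).
    rewrite Rabs_pos_eq in HN by (apply pow_le; lra).
    eapply Rle_lt_trans; [apply (norm_minus_trans (x N))|].
    rewrite (norm_minus_sym (x N) (x u)).
    pose proof (Hfar N (u - N)%nat) as H1. pose proof (Hfar N (v - N)%nat) as H2.
    replace (N + (u - N))%nat with u in H1 by lia.
    replace (N + (v - N))%nat with v in H2 by lia. lra. }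
  exists l. intros n. apply le_epsilon. intros eps Heps.
  pose proof (norm_factor_gt_0 (V := X)) as Hf.
  assert (He : 0 < eps / norm_factor (V := X)) by now apply Rdiv_lt_0_compat.
  destruct (proj1 (filterlim_locally (F := eventually) x l) Hl
    (mkposreal _ He)) as [N HN].
  specialize (HN (n + N)%nat ltac:(lia)).
  apply (norm_compat2 (V := X)) in HN. simpl in HN.
  replace (norm_factor * (eps / norm_factor)) with eps in HN by (field; lra).
  eapply Rle_trans; [apply (norm_minus_trans (x (n + N)%nat))|].
  rewrite (norm_minus_sym l).
  specialize (Hfar n N). lra.
Qed.

Lemma minus_plus_minus (G : AbelianGroup) (u w : G) :
  minus (plus u w) (minus u w) = plus w w.
Proof.
  change (plus (plus u w) (opp (plus u (opp w))) = plus w w).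
  rewrite opp_plus, opp_opp, (plus_comm u w).
  change (plus (plus w u) (plus (opp u) w) = plus w w).
  rewrite <- plus_assoc, (plus_assoc u), plus_opp_r.
  f_equal. exact (plus_zero_l w).
Qed.

Lemma plus_minus_l (G : AbelianGroup) (u w : G) : minus (plus u w) u = w.
Proof.
  change (plus (plus u w) (opp u) = w).
  rewrite (plus_comm u), <- plus_assoc, plus_opp_r. exact (plus_zero_r w).
Qed.

(** Moving from [u] by [w] in one of the two opposite directions lands at norm at
    least that of [w], because [w] is half the difference of the two endpoints.
    Applied to images under a linear map, this makes a hump survive whatever
    was built before it. *)
Lemma norm_le_max_plus_minus (k : scalar_field) (X : NormedModule (scalars k))
    (u w : X) :
  norm w <= Rmax (norm (plus u w)) (norm (minus u w)).
Proof.
  assert (Hw : w = scal (of_R k (1 / 2)) (minus (plus u w) (minus u w))).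
  { transitivity (scal (of_R k (1 / 2)) (plus w w));
      [|f_equal; symmetry; exact (minus_plus_minus u w)].
    assert (Hone : plus (of_R k (1 / 2)) (of_R k (1 / 2)) = of_R k 1).
    { transitivity (of_R k (1 / 2 + 1 / 2)); [|f_equal; lra].
      destruct k; [reflexivity|]. symmetry. apply RtoC_plus. }
    transitivity (scal (plus (of_R k (1 / 2)) (of_R k (1 / 2))) w).
    { now rewrite Hone, scal_of_R_one. }
    exact (eq_trans (scal_distr_r _ _ w) (eq_sym (scal_distr_l _ w w))). }
  rewrite Hw at 1.
  eapply Rle_trans; [apply norm_scal_of_R_le; lra|].
  assert (H : norm (minus (plus u w) (minus u w))
              <= norm (plus u w) + norm (minus u w)).
  { rewrite <- (norm_opp (minus u w)). exact (norm_triangle _ _). }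
  pose proof (Rmax_l (norm (plus u w)) (norm (minus u w))).
  pose proof (Rmax_r (norm (plus u w)) (norm (minus u w))). lra.
Qed.

Lemma linear_minus (K : AbsRing) (X Y : NormedModule K) (A : X -> Y) :
  is_linear A -> forall x y, A (minus x y) = minus (A x) (A y).
Proof.
  intros HA x y.
  assert (Hopp : A (opp y) = opp (A y)).
  { transitivity (A (scal (opp one) y)).
    - f_equal. symmetry. exact (scal_opp_one y).
    - rewrite (linear_scal A HA). exact (scal_opp_one (A y)). }
  transitivity (plus (A x) (A (opp y))); [exact (linear_plus A HA x (opp y))|].
  now rewrite Hopp.
Qed.

(** Sum vectors [v n] of length at most [(1/3)^n] that almost attain the norm
    [c n] of [A n], choosing each sign so that the hump created by [v n] is not
    cancelled by the earlier terms.  The later terms have total length at most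
    [(1/3)^n / 2], so they remove at most 1/2 of the 2/3 of [c n * (1/3)^n] that
    the hump holds.  What survives is 1/6 of it, and [c n >= 4^n]. *)
Lemma condensation_of_singularities (k : scalar_field)
    (X : CompleteNormedModule (scalars k)) (Y : NormedModule (scalars k))
    (A : nat -> (X : NormedModule (scalars k)) -> Y) :
  (forall n, is_linear (A n)) ->
  (forall n, ~ (forall x, norm (A n x) <= 4 ^ n * norm x)) ->
  exists x, forall n, (4 / 3) ^ n / 6 <= norm (A n x).
Proof.
  intros HA Hbig.
  assert (Hpos : forall n, 0 < (1 / 3) ^ n) by (intros; apply pow_lt; lra).
  destruct (functional_choice (fun n
    (cv : R * (X : NormedModule (scalars k))) =>
    4 ^ n <= fst cv /\
    (forall x, norm (A n x) <= fst cv * norm x) /\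
    norm (snd cv) <= (1 / 3) ^ n /\
    2 / 3 * fst cv * (1 / 3) ^ n <= norm (A n (snd cv)))) as [cv Hcv].
  { intros n.
    destruct (near_norming_vector (HA n) (pow_lt 4 n ltac:(lra)) (Hpos n)
      (Hbig n)) as [c [v H]].
    now exists (c, v). }
  set (x := fix x (n : nat) : (X : NormedModule (scalars k)) := match n with
    | O => zero
    | S m =>
        if Rle_dec (norm (A m (snd (cv m))))
             (norm (A m (plus (x m) (snd (cv m)))))
        then plus (x m) (snd (cv m)) else minus (x m) (snd (cv m))
    end).
  assert (Hlarge : forall n, norm (A n (snd (cv n))) <= norm (A n (x (S n)))).
  { intros n. simpl.
    pose proof (norm_le_max_plus_minus (A n (x n)) (A n (snd (cv n)))) as H.
    rewrite <- (linear_plus _ (HA n)), <- (linear_minus (HA n)) in H.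
    destruct Rle_dec as [Hle | Hgt]; [assumption|].
    apply Rmax_Rle in H. destruct H as [H | H]; [elim Hgt|]; exact H. }
  destruct (geometric_steps_limit (x := x)) as [l Hl].
  { intros n. destruct (Hcv n) as [_ [_ [Hv _]]]. simpl x.
    destruct Rle_dec.
    - now rewrite (plus_minus_l (x n)).
    - unfold minus at 2. rewrite (plus_minus_l (x n)).
      now rewrite (norm_opp (V := X)). }
  exists l. intros n.
  destruct (Hcv n) as [Hc [Hbound [_ Hv]]]. specialize (Hlarge n).
  specialize (Hl (S n)). simpl pow in Hl.
  pose proof (Hbound (minus l (x (S n)))) as Hdiff.
  rewrite (linear_minus (HA n)) in Hdiff.
  pose proof (norm_triangle_inv (A n l) (A n (x (S n)))) as Htri.
  apply Rabs_le_between in Htri.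
  assert (H4 : 0 < 4 ^ n) by (apply pow_lt; lra).
  assert (Heq : (4 / 3) ^ n = 4 ^ n * (1 / 3) ^ n).
  { rewrite <- Rpow_mult_distr. f_equal. lra. }
  assert (Hmul : fst (cv n) * norm (minus l (x (S n)))
     <= fst (cv n) * (3 / 2 * (1 / 3 * (1 / 3) ^ n))).
  { apply Rmult_le_compat_l; [lra | exact Hl]. }
  assert (Hmul2 : 4 ^ n * (1 / 3) ^ n <= fst (cv n) * (1 / 3) ^ n).
  { apply Rmult_le_compat_r; [apply Rlt_le, Hpos | exact Hc]. }
  rewrite Heq. lra.
Qed.

(** If no bound is uniform, there are times [t n] tending to 0 at which [T (t n)]
    has norm above [4 ^ n]; a single vector whose images there grow like
    [(4/3)^n] contradicts the bound on its own orbit. *)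
Lemma uniformly_bounded_near_zero (k : scalar_field)
    (X : CompleteNormedModule (scalars k)) (Y : NormedModule (scalars k))
    (T : R -> X -> Y) :
  (forall t, 0 <= t -> is_linear (T t)) ->
  (forall x, exists c d, 0 < d /\ forall t, 0 <= t < d -> norm (T t x) <= c) ->
  exists C d, 0 < d /\
    forall t x, 0 <= t < d -> norm (T t x) <= C * norm x.
Proof.
  intros HT Hpt. apply NNPP. intros Hno.
  destruct (functional_choice (fun (n : nat) t => 0 <= t < / INR (S n) /\
    ~ (forall x, norm (T t x) <= 4 ^ n * norm x))) as [t Ht].
  { intros n. apply NNPP. intros Hn. apply Hno.
    exists (4 ^ n), (/ INR (S n)). split.
    - apply Rinv_0_lt_compat, lt_0_INR. lia.
    - intros t x Ht. revert x. apply NNPP. intros H. apply Hn. now exists t. }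
  destruct (@condensation_of_singularities k X Y (fun n => T (t n))) as [x Hx].
  { intros n. apply HT, Ht. }
  { intros n. apply Ht. }
  destruct (Hpt x) as [c [d [Hd Hc]]].
  destruct (archimed_cor1 d Hd) as [N1 [HN1 HN1']].
  destruct (Pow_x_infinity (4 / 3)) with (b := 6 * (c + 1)) as [N2 HN2].
  { rewrite Rabs_pos_eq; lra. }
  set (n := Nat.max N1 N2).
  specialize (HN2 n (Nat.le_max_r _ _)).
  rewrite Rabs_pos_eq in HN2 by (apply pow_le; lra).
  specialize (Hx n).
  assert (Htn : t n < d).
  { destruct (Ht n) as [[_ H] _]. eapply Rlt_trans; [exact H|].
    eapply Rle_lt_trans; [|exact HN1]. apply Rinv_le_contravar.
    - now apply lt_0_INR.
    - apply le_INR. unfold n. lia. }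
  specialize (Hc (t n) (conj (proj1 (proj1 (Ht n))) Htn)). lra.
Qed.

(** * Growth of strongly continuous semigroups *)

Lemma C0_orbit_bounded_near_zero (k : scalar_field) (X : NormedModule (scalars k))
    (T : R -> X -> X) :
  C0_semigroup T ->
  forall x, exists c d, 0 < d /\ forall t, 0 <= t < d -> norm (T t x) <= c.
Proof.
  intros HT x.
  pose proof (C0_continuous HT (x := x) (Rle_refl 0)) as Hlim.
  destruct (Hlim _ (locally_ball (T 0 x) (mkposreal 1 Rlt_0_1))) as [d Hd].
  exists (norm (T 0 x) + norm_factor (V := X)), d. split; [apply cond_pos|].
  intros t Ht.
  assert (Hb : ball (T 0 x) (mkposreal 1 Rlt_0_1) (T t x)).
  { apply Hd; [|apply Ht]. unfold ball; simpl.
    unfold AbsRing_ball, abs, minus, plus, opp; simpl.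
    rewrite Rabs_pos_eq; lra. }
  apply norm_compat2 in Hb. simpl in Hb.
  pose proof (norm_triangle_inv (T t x) (T 0 x)) as H.
  apply Rabs_le_between in H. lra.
Qed.

(** Each further time step of length [a], on which the norm is at most [exp L],
    costs a factor [exp L = exp (L / a * a)], which is exactly the growth of the
    claimed bound over that step. *)
Lemma C0_semigroup_exponential_bound (k : scalar_field)
    (X : CompleteNormedModule (scalars k)) (T : R -> X -> X) :
  C0_semigroup T ->
  exists C w, 0 < C /\ 0 <= w /\
    forall t x, 0 <= t -> norm (T t x) <= C * exp (w * t) * norm x.
Proof.
  intros HT.
  destruct (uniformly_bounded_near_zero (C0_bounded_linear HT)
    (C0_orbit_bounded_near_zero HT)) as [B [d [Hd HB]]].
  set (a := d / 2). set (L := Rmax B 0).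
  assert (HL : forall t x, 0 <= t <= a -> norm (T t x) <= exp L * norm x).
  { intros t x Ht. eapply Rle_trans; [apply HB; unfold a in Ht; lra|].
    apply Rmult_le_compat_r; [apply norm_ge_0|].
    pose proof (Rmax_l B 0). pose proof (exp_ineq1_le L).
    unfold L in *. lra. }
  assert (Ha : 0 < a) by (unfold a; lra).
  assert (HL0 : 0 <= L / a).
  { apply Rdiv_le_0_compat; [apply Rmax_r | assumption]. }
  exists (exp L), (L / a). split; [apply exp_pos|]. split; [assumption|].
  assert (Hind : forall n t x, 0 <= t <= INR n * a ->
            norm (T t x) <= exp L * exp (L / a * t) * norm x).
  { assert (Hsmall : forall t x, 0 <= t <= a ->
            norm (T t x) <= exp L * exp (L / a * t) * norm x).
    { intros t x Ht. eapply Rle_trans; [now apply HL|].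
      apply Rmult_le_compat_r; [apply norm_ge_0|].
      rewrite <- (Rmult_1_r (exp L)) at 1.
      apply Rmult_le_compat_l; [apply Rlt_le, exp_pos|].
      pose proof (exp_ineq1_le (L / a * t)).
      assert (0 <= L / a * t) by (apply Rmult_le_pos; lra). lra. }
    induction n as [|n IH]; intros t x Ht.
    - apply Hsmall. simpl in Ht. lra.
    - destruct (Rle_dec t a) as [Hta | Hta]; [apply Hsmall; lra|].
      rewrite S_INR in Ht.
      replace t with (a + (t - a)) at 1 by lra.
      rewrite (C0_add HT) by lra.
      eapply Rle_trans; [apply HL; lra|].
      replace (exp L * exp (L / a * t)) with
        (exp L * (exp L * exp (L / a * (t - a)))).
      + rewrite Rmult_assoc. apply Rmult_le_compat_l; [apply Rlt_le, exp_pos|].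
        apply IH. lra.
      + rewrite <- (exp_plus L (L / a * (t - a))). do 2 f_equal. field. lra. }
  intros t x Ht.
  destruct (nfloor_ex (t / a)) as [n Hn].
  { now apply Rdiv_le_0_compat. }
  apply (Hind (S n)). split; [assumption|]. rewrite S_INR.
  replace t with (t / a * a) by (field; lra).
  apply Rmult_le_compat_r; lra.
Qed.

(** * Triangular operators *)

(** [E] is an invariant subspace of the triangular operators, on which they act
    as [T]. *)
Lemma C0_semigroup_upper_left (k : scalar_field)
    (E F : NormedModule (scalars k))
    (T : R -> E -> E) (U : R -> F -> E) (S : R -> F -> F) :
  (forall t, 0 <= t -> is_linear (T t)) ->
  (forall t, 0 <= t -> is_linear (U t)) ->
  (forall t, 0 <= t -> is_linear (S t)) ->
  C0_semigroup (fun t => upper_triangular (T t) (U t) (S t)) ->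
  C0_semigroup T.
Proof.
  intros HT HU HS HC.
  assert (Hemb : forall t x, 0 <= t ->
    upper_triangular (T t) (U t) (S t) (x, zero) = (T t x, zero)).
  { intros t x Ht. unfold upper_triangular. simpl.
    rewrite (linear_zero _ (HU t Ht)), (linear_zero _ (HS t Ht)).
    f_equal. exact (plus_zero_r _). }
  split; [exact HT | | |].
  - intros x. pose proof (C0_zero HC (x, zero)) as H. simpl in H.
    rewrite Hemb in H by apply Rle_refl. now injection H.
  - intros s t x Hs Ht. pose proof (C0_add HC (x, zero) Hs Ht) as H. simpl in H.
    rewrite !Hemb in H by (try assumption; lra). now injection H.
  - intros x t Ht. pose proof (C0_continuous HC (x := (x, zero)) Ht) as H.
    cbv beta in H. rewrite Hemb in H by assumption.
    apply (filterlim_within_ext (F := locally t)) with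
      (f := fun s => fst (upper_triangular (T s) (U s) (S s) (x, zero))).
    { intros s Hs. now rewrite Hemb. }
    eapply filterlim_comp; [exact H|]. exact (continuous_fst (T t x) (zero : F)).
Qed.

(** [F] is the quotient by that invariant subspace, so only the second component
    matters. *)
Lemma C0_semigroup_lower_right (k : scalar_field)
    (E F : NormedModule (scalars k))
    (T : R -> E -> E) (U : R -> F -> E) (S : R -> F -> F) :
  (forall t, 0 <= t -> is_linear (S t)) ->
  C0_semigroup (fun t => upper_triangular (T t) (U t) (S t)) ->
  C0_semigroup S.
Proof.
  intros HS HC. split; [exact HS | | |].
  - intros y. exact (f_equal snd (C0_zero HC (zero, y))).
  - intros s t y Hs Ht. exact (f_equal snd (C0_add HC (zero, y) Hs Ht)).
  - intros y t Ht. pose proof (C0_continuous HC (x := (zero, y)) Ht) as H.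
    cbv beta in H.
    exact (filterlim_comp _ _ _ _ snd _ _ _ H (continuous_snd _ _)).
Qed.

Lemma upper_triangular_comp (k : scalar_field)
    (E F : NormedModule (scalars k))
    (T1 T2 : E -> E) (U1 U2 : F -> E) (S1 S2 : F -> F) :
  is_linear T2 ->
  forall z, upper_triangular T2 U2 S2 (upper_triangular T1 U1 S1 z) =
    upper_triangular (fun x => T2 (T1 x))
      (fun y => plus (T2 (U1 y)) (U2 (S1 y))) (fun y => S2 (S1 y)) z.
Proof.
  intros HT z. unfold upper_triangular. simpl.
  rewrite (linear_plus _ HT), <- plus_assoc. reflexivity.
Qed.

Lemma is_linear_iter (K : AbsRing) (X : NormedModule K) (P : X -> X) (n : nat) :
  is_linear P -> is_linear (Nat.iter n P).
Proof.
  intros HP. induction n as [|n IH]; simpl; [apply is_linear_id|].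
  exact (is_linear_comp (Nat.iter n P) P IH HP).
Qed.

Lemma snd_iter_upper_triangular (k : scalar_field)
    (E F : NormedModule (scalars k))
    (P : E -> E) (Q : F -> E) (V : F -> F) (n : nat)
    (z : prod_NormedModule (scalars k) E F) :
  snd (Nat.iter n (upper_triangular P Q V) z) = Nat.iter n V (snd z).
Proof. induction n as [|n IH]; [reflexivity|]. exact (f_equal V IH). Qed.

(** The corner of the [n]-th power is a sum of [n] terms [P^(n-1-j) Q V^j].
    Carrying an extra power [P^m] in front lets the induction on [n] add them one
    at a time without writing the sum: the next step turns [P^m] of the new state
    into [P^(m+1)] of the old one plus a single term [P^m Q V^n].  Bounding the
    powers of [P] as a whole is what keeps the constant [M] from being raised to
    the power [n]. *)
Lemma fst_iter_upper_triangular_le (k : scalar_field)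
    (E F : NormedModule (scalars k))
    (P : E -> E) (Q : F -> E) (V : F -> F) (M q r : R) :
  is_linear P -> 0 <= M -> 0 <= q -> 0 <= r ->
  (forall n x, norm (Nat.iter n P x) <= M * r ^ n * norm x) ->
  (forall n y, norm (Nat.iter n V y) <= M * r ^ n * norm y) ->
  (forall y, norm (Q y) <= q * r * norm y) ->
  forall n m z,
    norm (Nat.iter m P (fst (Nat.iter n (upper_triangular P Q V) z))) <=
    M * r ^ (m + n) * norm (fst z) +
    INR n * (M * M * q * r ^ (m + n)) * norm (snd z).
Proof.
  intros HP HM Hq Hr HPn HVn HQ n.
  induction n as [|n IH]; intros m z.
  - rewrite Nat.add_0_r. specialize (HPn m (fst z)). simpl. lra.
  - set (w := Nat.iter n (upper_triangular P Q V) z).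
    change (Nat.iter (S n) (upper_triangular P Q V) z)
      with (upper_triangular P Q V w).
    unfold upper_triangular at 1. simpl fst.
    rewrite (linear_plus _ (is_linear_iter m HP)).
    eapply Rle_trans; [exact (norm_triangle _ _)|].
    assert (H1 : norm (Nat.iter m P (P (fst w))) <=
      M * r ^ (S m + n) * norm (fst z) +
      INR n * (M * M * q * r ^ (S m + n)) * norm (snd z)).
    { rewrite <- Nat.iter_succ_r. apply IH. }
    assert (H2 : norm (Nat.iter m P (Q (snd w))) <=
      M * M * q * r ^ (S m + n) * norm (snd z)).
    { unfold w. rewrite snd_iter_upper_triangular.
      replace (M * M * q * r ^ (S m + n) * norm (snd z)) with
        (M * r ^ m * (q * r * (M * r ^ n * norm (snd z))))
        by (simpl; rewrite pow_add; ring).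
      eapply Rle_trans; [apply HPn|].
      apply Rmult_le_compat_l; [apply Rmult_le_pos; [|apply pow_le]; assumption|].
      eapply Rle_trans; [apply HQ|].
      apply Rmult_le_compat_l; [now apply Rmult_le_pos|]. apply HVn. }
    replace (m + S n)%nat with (S m + n)%nat by lia. rewrite S_INR.
    lra.
Qed.

(** * Trotter products *)

Lemma exp_pow (x : R) (n : nat) : exp x ^ n = exp (INR n * x).
Proof.
  induction n as [|n IH].
  - simpl. now rewrite Rmult_0_l, exp_0.
  - rewrite S_INR. simpl pow. rewrite IH, <- exp_plus. f_equal. ring.
Qed.

Lemma exp_le_compat (x y : R) : x <= y -> exp x <= exp y.
Proof.
  intros [H | ->]; [|apply Rle_refl]. now apply Rlt_le, exp_increasing.
Qed.

(** The hypothesis ties the number of factors to the time; taking the time to be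
    [n * s] frees them, so that all powers of one and the same step [s] are
    bounded. *)
Lemma trotter_product_power_bound (k : scalar_field)
    (X : NormedModule (scalars k)) (T1 T2 : R -> X -> X) (M w : R) :
  1 <= M ->
  (forall t, 0 <= t -> is_linear (T1 t) /\ is_linear (T2 t)) ->
  (forall (t : R) (n : nat), 0 <= t -> (1 <= n)%nat ->
    Rbar_le (op_norm (trotter_product T1 T2 t n)) (M * exp (w * t))) ->
  forall s n x, 0 <= s ->
    norm (Nat.iter n (fun u => T2 s (T1 s u)) x) <=
    M * exp (w * s) ^ n * norm x.
Proof.
  intros HM Hlin Hbound s n x Hs.
  (* The hypothesis excludes n = 0; there the bound is where 1 <= M is used. *)
  destruct n as [|n].
  { simpl. pose proof (norm_ge_0 x). nra. }
  assert (Hn : 0 < INR (S n)) by (apply lt_0_INR; lia).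
  assert (Ht : 0 <= INR (S n) * s) by (apply Rmult_le_pos; lra).
  pose proof (Hbound _ (S n) Ht ltac:(lia)) as H.
  unfold trotter_product in H.
  replace (INR (S n) * s / INR (S n)) with s in H by (field; lra).
  replace (exp (w * s) ^ S n) with (exp (w * (INR (S n) * s))).
  - revert x. apply op_norm_le_linear; [|exact H].
    apply is_linear_iter. destruct (Hlin s Hs). now apply is_linear_comp.
  - rewrite exp_pow. f_equal. ring.
Qed.

Theorem theorem2p2 (k : scalar_field)
    (E F : CompleteNormedModule (scalars k))
    (A1 A2 : operator (prod_NormedModule (scalars k) E F))
    (T1 T2 : R -> E -> E) (R1 R2 : R -> F -> E) (S1 S2 : R -> F -> F)
    (hT : forall t, 0 <= t -> is_linear (T1 t) /\ is_linear (T2 t))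
    (hR : forall t, 0 <= t -> is_linear (R1 t) /\ is_linear (R2 t))
    (hS : forall t, 0 <= t -> is_linear (S1 t) /\ is_linear (S2 t))
    (hA1 : generates A1 (fun t => upper_triangular (T1 t) (R1 t) (S1 t)))
    (hA2 : generates A2 (fun t => upper_triangular (T2 t) (R2 t) (S2 t)))
    (hbound : exists M' K w' : R, 1 <= M' /\ 0 < K /\
      (forall (t : R) (n : nat), 0 <= t -> (1 <= n)%nat ->
        Rbar_le (op_norm (trotter_product T1 T2 t n)) (M' * exp (w' * t)) /\
        Rbar_le (op_norm (trotter_product S1 S2 t n)) (M' * exp (w' * t))) /\
      (forall t : R, 0 <= t ->
        Rbar_le (op_norm (R1 t)) (K * t * exp (w' * t)) /\
        Rbar_le (op_norm (R2 t)) (K * t * exp (w' * t)))) :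
  exists M w : R, 1 <= M /\
    forall (t : R) (n : nat), 0 <= t -> (1 <= n)%nat ->
      Rbar_le
        (op_norm
          (trotter_product
            (fun s => upper_triangular (T1 s) (R1 s) (S1 s))
            (fun s => upper_triangular (T2 s) (R2 s) (S2 s)) t n))
        (M * exp (w * t)).
Proof.
  destruct hbound as [M [K [w [HM [HK [Hprod Hoff]]]]]].
  destruct (@C0_semigroup_exponential_bound k E T2) as [Ca [wa [HCa [Hwa HT2]]]].
  { apply C0_semigroup_upper_left with (4 := proj1 hA2); intros t Ht;
      [apply hT | apply hR | apply hS]; exact Ht. }
  destruct (@C0_semigroup_exponential_bound k F S1) as [Cb [wb [HCb [Hwb HS1]]]].
  { apply C0_semigroup_lower_right with (2 := proj1 hA1); intros t Ht;
      apply hS; exact Ht. }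
  pose proof (trotter_product_power_bound HM hT
    (fun t n ht hn => proj1 (Hprod t n ht hn))) as HP.
  pose proof (trotter_product_power_bound HM hS
    (fun t n ht hn => proj2 (Hprod t n ht hn))) as HV.
  set (D := (Ca + Cb) * K).
  assert (HD : 0 < D) by (apply Rmult_lt_0_compat; lra).
  assert (HQ : forall s y, 0 <= s ->
    norm (plus (T2 s (R1 s y)) (R2 s (S1 s y))) <=
    D * s * exp ((wa + wb) * s) * exp (w * s) * norm y).
  { intros s y Hs.
    pose proof (norm_ge_0 y) as Hy.
    assert (HR1 := op_norm_le_linear (proj1 (hR s Hs)) (proj1 (Hoff s Hs)) y).
    assert (HR2 := op_norm_le_linear (proj2 (hR s Hs)) (proj2 (Hoff s Hs)) (S1 s y)).
    pose proof (HT2 s (R1 s y) Hs) as H2. pose proof (HS1 s y Hs) as H1.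
    set (ew := exp (w * s)) in *.
    assert (Hew : 0 < ew) by apply exp_pos.
    assert (Hmono : forall u, 0 <= u -> u <= wa + wb ->
              exp (u * s) <= exp ((wa + wb) * s)).
    { intros u Hu0 Hu. apply exp_le_compat. now apply Rmult_le_compat_r. }
    set (em := exp ((wa + wb) * s)) in *.
    pose proof (Hmono wa Hwa ltac:(lra)) as Ha.
    pose proof (Hmono wb Hwb ltac:(lra)) as Hb.
    assert (HKs : 0 <= K * s * ew * norm y).
    { repeat apply Rmult_le_pos; lra. }
    eapply Rle_trans; [exact (norm_triangle _ _)|].
    replace (D * s * em * ew * norm y) with
      (Ca * em * (K * s * ew * norm y) + K * s * ew * (Cb * em * norm y))
      by (unfold D; ring).
    apply Rplus_le_compat.
    - eapply Rle_trans; [exact H2|].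
      apply Rmult_le_compat; [| apply norm_ge_0 | | exact HR1].
      + apply Rlt_le, Rmult_lt_0_compat; [assumption | apply exp_pos].
      + apply Rmult_le_compat_l; lra.
    - eapply Rle_trans; [exact HR2|].
      apply Rmult_le_compat_l; [repeat apply Rmult_le_pos; lra|].
      eapply Rle_trans; [exact H1|].
      apply Rmult_le_compat_r; [assumption|]. apply Rmult_le_compat_l; lra. }
  (* M bounds the diagonal part and M^2 D the corner; in the exponent,
     wa + wb comes from T2(s) and S1(s), and 1 absorbs the factor n s = t by
     t <= exp t.  The factor 2 is for the product norm. *)
  set (c := M + M * M * D).
  assert (HMM : 1 <= M * M) by nra.
  assert (HMD : 0 < M * M * D) by (apply Rmult_lt_0_compat; lra).
  exists (2 * c), (w + wa + wb + 1). split; [unfold c; lra|].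
  intros t n Ht Hn. apply op_norm_le. intros z Hz.
  set (s := t / INR n).
  assert (HINR : 1 <= INR n) by now apply (le_INR 1).
  assert (Hs : 0 <= s) by (apply Rdiv_le_0_compat; lra).
  assert (Hns : INR n * s = t) by (unfold s; field; lra).
  assert (Hst : s <= t) by nra.
  assert (Hpow : exp (w * s) ^ n = exp (w * t)).
  { rewrite exp_pow, <- Hns. f_equal. ring. }
  unfold trotter_product. fold s.
  rewrite (Nat.iter_swap_gen _ _ (fun u => u) _ _
    (upper_triangular_comp (T1 s) (R1 s) (R2 s) (S1 s) (S2 s)
      (proj2 (hT s Hs)))).
  cbv beta.
  set (P := fun x => T2 s (T1 s x)).
  set (Q := fun y => plus (T2 s (R1 s y)) (R2 s (S1 s y))).
  set (V := fun y => S2 s (S1 s y)).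
  set (q := D * s * exp ((wa + wb) * s)).
  assert (Hq : 0 <= q).
  { apply Rmult_le_pos; [apply Rmult_le_pos; lra | apply Rlt_le, exp_pos]. }
  destruct z as [x y].
  pose proof (norm_prod x y) as [Hxy _].
  pose proof (Rmax_l (norm x) (norm y)). pose proof (Rmax_r (norm x) (norm y)).
  assert (Hx : norm x <= 1) by lra. assert (Hy : norm y <= 1) by lra.
  assert (HPlin : is_linear P).
  { apply (is_linear_comp (T1 s) (T2 s)); apply (hT s Hs). }
  assert (Hfst : norm (fst (Nat.iter n (upper_triangular P Q V) (x, y))) <=
    M * exp (w * s) ^ n * norm x +
    INR n * (M * M * q * exp (w * s) ^ n) * norm y).
  { exact (fst_iter_upper_triangular_le HPlin (Rle_trans _ _ _ Rle_0_1 HM) Hq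
      (Rlt_le _ _ (exp_pos _)) (fun n x => HP s n x Hs) (fun n x => HV s n x Hs)
      (fun y => HQ s y Hs) n 0%nat (x, y)). }
  assert (Hsnd : norm (snd (Nat.iter n (upper_triangular P Q V) (x, y))) <=
    M * exp (w * s) ^ n * norm y).
  { rewrite (snd_iter_upper_triangular P Q V n (x, y)). exact (HV s n y Hs). }
  rewrite Hpow in Hfst, Hsnd.
  change (norm (Nat.iter n (upper_triangular P Q V) (x, y)) <=
    2 * c * exp ((w + wa + wb + 1) * t)).
  destruct (Nat.iter n (upper_triangular P Q V) (x, y)) as [x' y'].
  simpl in Hfst, Hsnd.
  set (e := exp ((w + wa + wb + 1) * t)).
  assert (He1 : exp (w * t) <= e) by (apply exp_le_compat; nra).
  assert (He2 : t * exp ((wa + wb) * s) * exp (w * t) <= e).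
  { unfold e.
    replace ((w + wa + wb + 1) * t) with (t + (wa + wb) * t + w * t) by ring.
    rewrite !exp_plus.
    apply Rmult_le_compat_r; [apply Rlt_le, exp_pos|].
    apply Rmult_le_compat; [lra | apply Rlt_le, exp_pos | |].
    - pose proof (exp_ineq1_le t). lra.
    - apply exp_le_compat. apply Rmult_le_compat_l; lra. }
  assert (Hew : 0 < exp (w * t)) by apply exp_pos.
  assert (Hfst' : norm x' <= c * e).
  { eapply Rle_trans; [exact Hfst|]. unfold c. rewrite Rmult_plus_distr_r.
    apply Rplus_le_compat.
    - apply Rle_trans with (M * exp (w * t) * 1).
      + apply Rmult_le_compat_l; [apply Rmult_le_pos; lra | exact Hx].
      + rewrite Rmult_1_r. apply Rmult_le_compat_l; lra.
    - replace (INR n * (M * M * q * exp (w * t))) with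
        (M * M * D * (t * exp ((wa + wb) * s) * exp (w * t)))
        by (rewrite <- Hns at 1; unfold q; ring).
      assert (0 <= t * exp ((wa + wb) * s) * exp (w * t)).
      { repeat apply Rmult_le_pos; [lra | apply Rlt_le, exp_pos | lra]. }
      pose proof (norm_ge_0 y).
      rewrite <- (Rmult_1_r (M * M * D * e)).
      apply Rmult_le_compat; [apply Rmult_le_pos; lra | lra | | exact Hy].
      apply Rmult_le_compat_l; lra. }
  assert (Hsnd' : norm y' <= c * e).
  { eapply Rle_trans; [exact Hsnd|]. pose proof (norm_ge_0 y).
    rewrite <- (Rmult_1_r (c * e)).
    apply Rmult_le_compat; [apply Rmult_le_pos; lra | lra | | exact Hy].
    apply Rmult_le_compat; unfold c; lra. }
  eapply Rle_trans; [apply norm_prod|].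
  assert (Hsqrt : sqrt 2 <= 2).
  { rewrite <- (sqrt_square 2) at 2 by lra. apply sqrt_le_1_alt. lra. }
  rewrite (Rmult_assoc 2).
  apply Rmult_le_compat; [apply sqrt_pos | | exact Hsqrt |].
  - eapply Rle_trans; [apply (norm_ge_0 x')|apply Rmax_l].
  - now apply Rmax_lub.
Qed.
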